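(* Consider a differentiable parametrization of conditional probabilities $\{m_\theta:\theta\in\mathbb R^p\}=\operatorname{int}(\Delta_{\mathbb X}^n)$, where $n\in\mathbb N$ and $\mathbb X$ is a finite set, and suppose that $\operatorname{span}\{\partial_{\theta_i}m_\theta:i=1,\dots,p\}=T\Delta_{\mathbb X}^n$ for all $\theta\in\mathbb R^p$. Define a corresponding parametric independence model as $$\mu_\theta(x):=\prod_{i=1}^n m_\theta(x_i|i)\quad\text{for all }x\in\mathbb X^n .$$ Further, consider $$c\in\operatorname{span}\left\{\mathbf 1_{\mathbb X}\otimes\cdots\otimes\underset{i\text{-th}}{\delta_x}\otimes\cdots\otimes\mathbf 1_{\mathbb X}:x\in\mathbb X,\ i=1,\dots,n\right\}\subseteq\mathbb R^{\mathbb X^n}$$ and the linear payoff $f(\mu)=c^\top\mu$ and the natural gradient flow $\partial_t\theta_t=F(\theta_t)^+\nabla f(\theta_t)$, where $f(\theta)=f(\mu_\theta)$. Then $(\mu_{\theta_t})_{t\ge0}$ solves the Fisher-Rao gradient flow in $\Delta_{\mathbb X^n}$ and hence, writing $\mu_t=\mu_{\theta_t}$, we have $$\mu_t(x)=\frac{e^{tc(x)}}{\sum_{x'}e^{tc(x')}}\quad\text{for all }x\in\mathbb X^n ,$$ where the sum runs over $x'\in\mathbb X^n$.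
   Context: For a finite set $\mathbb Y$, $\Delta_{\mathbb Y}=\{\mu\in\mathbb R^{\mathbb Y}_{\ge0}:\sum_y\mu_y=1\}$ is the probability simplex. $\Delta_{\mathbb X}^n$ is the $n$-fold Cartesian product of $\Delta_{\mathbb X}$ (the conditional probability polytope), whose elements are written $m=(m(\cdot|i))_{i=1,\dots,n}$. For a polytope $P$, $\operatorname{int}(P)$ is its relative interior and $TP$ is the linear part of its affine hull. $\mathbf 1_{\mathbb X}\in\mathbb R^{\mathbb X}$ is the all-one vector and $\delta_x\in\mathbb R^{\mathbb X}$ is the indicator vector of $x$; in the tensor product, $\delta_x$ sits in the $i$-th slot and $\mathbf 1_{\mathbb X}$ in all others. The Fisher-Rao metric is $g^{\mathrm{FR}}_\mu(v,w)=\sum_y\frac{v_yw_y}{\mu_y}$ for $\mu$ with positive entries. The Fisher information matrix is $F(\theta)_{ij}=g^{\mathrm{FR}}_{\mu_\theta}(\partial_{\theta_i}\mu_\theta,\partial_{\theta_j}\mu_\theta)$, with pseudo-inverse $F(\theta)^+$; $\nabla f(\theta)$ is the Euclidean gradient with respect to $\theta$. For a polytope $P$, the Fisher-Rao gradient $\nabla^{\mathrm{FR}}_Pf(\mu)\in TP$ at $\mu\in\operatorname{int}(P)$ is determined by $g^{\mathrm{FR}}_\mu(\nabla^{\mathrm{FR}}_Pf(\mu),v)=\langle\nabla f(\mu),v\rangle$ for all $v\in TP$; the Fisher-Rao gradient flow in $P$ (with potential $f$) is $\partial_t\mu_t=\nabla^{\mathrm{FR}}_Pf(\mu_t)$.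
   Formalization: The printed formula for μ_t omits the initial condition and fails unless μ_0 is uniform; the theorem proves μ_t(x) = μ_0(x)e^{tc(x)}/Σ_{x'} μ_0(x')e^{tc(x')} for every start, and the printed formula when μ_0 is uniform. *)

(* Defs.v *)
From HB Require Import structures.
From mathcomp Require Import all_boot all_order all_algebra.
From mathcomp Require Import all_classical all_reals all_analysis.

Set Implicit Arguments.
Unset Strict Implicit.
Unset Printing Implicit Defensive.

Import Order.TTheory GRing.Theory Num.Theory.
Import numFieldNormedType.Exports.

Local Open Scope classical_set_scope.
Local Open Scope ring_scope.

(* [R^o] rather than [R], so that the space of vectors is a [vectType R]. *)
Notation "{ 'vec' R ^ Y }" := {ffun Y -> (R^o)%type}
  (at level 0, R at level 2, Y at level 99, format "{ 'vec'  R ^ Y }").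

Section Polytopes.
Variables (R : realType) (Y : finType).
Implicit Types (P : set {vec R ^ Y}) (u v : {vec R ^ Y}).

Definition affine_hull P : set {vec R ^ Y} :=
  [set v | exists (k : nat) (a : 'I_k -> R) (u : 'I_k -> {vec R ^ Y}),
     [/\ forall i, P (u i), \sum_(i < k) a i = 1
       & v = \sum_(i < k) a i *: u i]].

Definition tangent_space P : set {vec R ^ Y} :=
  [set v | exists a b, [/\ affine_hull P a, affine_hull P b & v = a - b]].

Definition relint P : set {vec R ^ Y} :=
  [set u | P u /\ exists2 e : R, 0 < e &
     forall v, affine_hull P v -> (forall y, `|v y - u y| < e) -> P v].

Definition simplex : set {vec R ^ Y} :=
  [set u | (forall y, 0 <= u y) /\ \sum_y u y = 1].

Definition delta_vec (y : Y) : {vec R ^ Y} := [ffun z => (z == y)%:R].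

Definition one_vec : {vec R ^ Y} := [ffun=> 1].

Definition dotv u v : R := \sum_y u y * v y.

Definition fisher_rao (mu v w : {vec R ^ Y}) : R :=
  \sum_y v y * w y / mu y.

Definition euclidean_grad (f : {vec R ^ Y} -> R) (mu : {vec R ^ Y}) :
    {vec R ^ Y} :=
  [ffun y => derive1 (fun h : R => f (mu + h *: delta_vec y)) 0].

Definition is_fisher_rao_grad P (f : {vec R ^ Y} -> R) (mu w : {vec R ^ Y}) :=
  tangent_space P w /\
  forall v, tangent_space P v ->
    fisher_rao mu w v = dotv (euclidean_grad f mu) v.

End Polytopes.

(* Derivative at [t] of a curve defined on [0, +oo[: the usual derivative for
   0 < t, the right derivative at t = 0. *)
Definition is_time_derive (R : realType) (V : normedModType R) (g : R -> V)
    (t : R) (v : V) : Prop :=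
  (fun h : R => h^-1 *: (g (t + h) - g t))
    @ within [set h | 0 <= t + h] 0^' --> v.

Definition fisher_rao_flow (R : realType) (Y : finType) (P : set {vec R ^ Y})
    (f : {vec R ^ Y} -> R) (mu : R -> {vec R ^ Y}) : Prop :=
  forall t, 0 <= t -> relint P (mu t) /\
    exists2 w, is_fisher_rao_grad P f (mu t) w &
      forall y, is_time_derive (fun s => mu s y : R^o) t (w y).

Section PseudoInverse.
Variable R : realType.

Definition penrose m n (A : 'M[R]_(m, n)) (B : 'M[R]_(n, m)) : Prop :=
  [/\ A *m B *m A = A, B *m A *m B = B,
      (A *m B)^T = A *m B & (B *m A)^T = B *m A].

Definition pseudo_inverse m n (A : 'M[R]_(m, n)) : 'M[R]_(n, m) :=
  xget 0 [set B | penrose A B].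

Lemma gram_unitmx m n (B : 'M[R]_(m, n)) :
  row_free B -> B *m B^T \in unitmx.
Proof.
move=> Bfree; rewrite -row_free_unit; apply/row_freeP.
have: row_free (B *m B^T).
  rewrite -kermx_eq0; apply/eqP/row_matrixP => i; rewrite row0.
  set v := row i _.
  have vG : v *m (B *m B^T) = 0 by rewrite -row_mul mulmx_ker row0.
  have vB : v *m B = 0.
    have : (v *m B) *m (v *m B)^T = 0.
      by rewrite trmx_mul !mulmxA -(mulmxA v) vG mul0mx.
    move=> /matrixP/(_ 0 0); rewrite !mxE => /eqP.
    rewrite psumr_eq0; last by move=> j _; rewrite [X in _ * X]mxE -expr2 sqr_ge0.
    move=> /allP h; apply/rowP => j; rewrite [RHS]mxE.
    have := h j (mem_index_enum j).
    by rewrite [X in _ * X]mxE mulf_eq0 orbb => /eqP.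
  by apply: (row_free_inj Bfree); rewrite vB mul0mx.
by move=> /row_freeP.
Qed.

Lemma penrose_factor m k n (c : 'M[R]_(m, k)) (r : 'M[R]_(k, n)) :
  row_free r -> row_full c -> exists B, penrose (c *m r) B.
Proof.
move=> rfree cfull.
have rU : r *m r^T \in unitmx by exact: gram_unitmx.
have cU : c^T *m c \in unitmx.
  rewrite -[X in _ *m X]trmxK; apply: gram_unitmx.
  by rewrite /row_free mxrank_tr.
pose ri := r^T *m invmx (r *m r^T); pose ci := invmx (c^T *m c) *m c^T.
have rri : r *m ri = 1%:M by rewrite /ri mulmxA mulmxV.
have cic : ci *m c = 1%:M by rewrite /ci -mulmxA mulVmx.
have AB : c *m r *m (ri *m ci) = c *m ci.
  by rewrite -(mulmxA c) (mulmxA r ri) rri mul1mx.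
have BA : (ri *m ci) *m (c *m r) = ri *m r.
  by rewrite -(mulmxA ri) (mulmxA ci c) cic mul1mx.
exists (ri *m ci); split.
- by rewrite AB -(mulmxA c) (mulmxA ci c) cic mul1mx.
- by rewrite BA -(mulmxA ri) (mulmxA r ri) rri mul1mx.
- by rewrite AB /ci !trmx_mul trmxK trmx_inv trmx_mul trmxK mulmxA.
- by rewrite BA /ri !trmx_mul trmxK trmx_inv trmx_mul trmxK mulmxA.
Qed.

Lemma penrose_exists m n (A : 'M[R]_(m, n)) : exists B, penrose A B.
Proof.
rewrite -(mulmx_base A); apply: penrose_factor.
- exact: row_base_free.
- exact: col_base_full.
Qed.

Lemma penrose_unique m n (A : 'M[R]_(m, n)) (B C : 'M[R]_(n, m)) :
  penrose A B -> penrose A C -> B = C.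
Proof.
move=> [ABA BAB tAB tBA] [ACA CAC tAC tCA].
have ABC : A *m B = A *m C.
  rewrite -tAB -{1}ACA -(mulmxA (A *m C) A B) trmx_mul tAB tAC.
  by rewrite mulmxA ABA.
have BCA : B *m A = C *m A.
  rewrite -tBA -{1}ACA !mulmxA -(mulmxA (B *m A) C A) trmx_mul tBA tCA.
  by rewrite -(mulmxA C A) (mulmxA A B A) ABA.
by rewrite -BAB -mulmxA ABC mulmxA BCA CAC.
Qed.

Lemma pseudo_inverseP m n (A : 'M[R]_(m, n)) : penrose A (pseudo_inverse A).
Proof. by have [B AB] := penrose_exists A; exact: (xgetI _ AB). Qed.

End PseudoInverse.

Section ParametricModels.
Variables (R : realType) (p : nat).

Definition param_partial (Y : finType) (q : 'cV[R]_p -> {vec R ^ Y})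
    (theta : 'cV[R]_p) (i : 'I_p) : {vec R ^ Y} :=
  [ffun y => 'D_(delta_mx i 0) (fun z => q z y : R^o) theta].

Definition param_grad (f : 'cV[R]_p -> R) (theta : 'cV[R]_p) : 'cV[R]_p :=
  \col_i 'D_(delta_mx i 0) (f : _ -> R^o) theta.

Definition fisher_matrix (Y : finType) (mu : 'cV[R]_p -> {vec R ^ Y})
    (theta : 'cV[R]_p) : 'M[R]_p :=
  \matrix_(i, j) fisher_rao (mu theta)
    (param_partial mu theta i) (param_partial mu theta j).

Definition natural_gradient_flow (Y : finType)
    (mu : 'cV[R]_p -> {vec R ^ Y}) (f : {vec R ^ Y} -> R)
    (theta : R -> 'cV[R]_p) : Prop :=
  forall t, 0 <= t ->
    is_time_derive theta t
      (pseudo_inverse (fisher_matrix mu (theta t)) *m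
       param_grad (fun z => f (mu z)) (theta t)).

End ParametricModels.

Section IndependenceModel.
Variables (R : realType) (X : finType) (n : nat).

(* The n-fold product of the simplex, as a subset of R^('I_n * X): the
   coordinate (i, x) stands for m(x|i). *)
Definition cond_simplex : set {vec R ^ 'I_n * X} :=
  [set m | forall i, simplex ([ffun x => m (i, x)] : {vec R ^ X})].

Definition tensor (v : 'I_n -> {vec R ^ X}) : {vec R ^ n.-tuple X} :=
  [ffun x => \prod_(i < n) v i (tnth x i)].

Definition slot_vec (i : 'I_n) (x : X) : {vec R ^ n.-tuple X} :=
  tensor (fun j => if j == i then delta_vec R x else one_vec R X).

Definition independence_model (p : nat) (m : 'cV[R]_p -> {vec R ^ 'I_n * X})
    (theta : 'cV[R]_p) : {vec R ^ n.-tuple X} :=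
  [ffun x => \prod_(i < n) m theta (i, tnth x i)].

End IndependenceModel.

(* Main.v *)
Require Import Defs.
From HB Require Import structures.
From mathcomp Require Import all_boot all_order all_algebra.
From mathcomp Require Import all_classical all_reals all_analysis.
From mathcomp Require Import ring.
Import Order.TTheory GRing.Theory Num.Theory.
Import numFieldNormedType.Exports.
Local Open Scope classical_set_scope.
Local Open Scope ring_scope.

Set Implicit Arguments.
Unset Strict Implicit.
Unset Printing Implicit Defensive.

(** Write [mu] for the model and [J_j] for its partial derivatives.  The
    Fisher-Rao gradient of [mu |-> c^T mu] in the simplex is the score
    [mu (c - k)], where [k] is the mean of [c] under [mu]
    ([fisher_rao_grad_score]).  The natural gradient moves [mu] by
    [\sum_j (F^+ grad f)_j J_j], and this is the orthogonal projection of the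
    Fisher-Rao gradient onto the span of the [J_j]: the Fisher matrix [F] is the
    Gram matrix of the [J_j], and [grad f] lists the inner products of the [J_j]
    with the Fisher-Rao gradient ([pseudo_inverse_projection]).  Everything
    rests on this projection losing nothing, that is, on the score of [c] being
    tangent to the model ([score_in_model_span]).  For [c] in the given span,
    [c x = \sum_i a_i (x_i)]; by the product rule, moving each factor
    [m(.|i)] along its own score [m(.|i) (a_i - k_i)] changes [mu] by
    [mu \sum_i (a_i - k_i) = mu (c - \sum_i k_i)], and the span hypothesis on
    [m] makes these moves of the factors available.

    Hence [d/dt mu_t = mu_t (c - k_t)], which is the Fisher-Rao flow.  For two
    outcomes [x], [y] the unknown [k_t] cancels in
    [ln (mu_t x) - ln (mu_t y) - t (c x - c y)], which is therefore constant;
    as the [mu_t x] sum to one, this determines them ([score_flow_gibbs]).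

    The flow only has a right derivative at time 0.  Extending the curve
    affinely to negative times turns it into a curve with a two-sided derivative
    at every nonnegative time ([time_derive_extension]), so that the usual chain
    rule and mean value theorem apply. *)

(** * Spans of finite families *)

Lemma mem_span_image (K : fieldType) (vT : vectType K) (I : finType)
    (f : I -> vT) (v : vT) :
  v \in <<[seq f i | i : I]>>%VS -> exists a : I -> K, v = \sum_i a i *: f i.
Proof.
rewrite span_def big_image /= => /memv_sumP[vs vsf ->].
have /choice[a aE] : forall i, exists k : K, vs i = k *: f i.
  by move=> i; apply/vlineP; exact: vsf.
by exists a; apply: eq_bigr.
Qed.

(** * Relative interiors and tangent spaces *)

Section Polytopes.
Variables (R : realType) (Y : finType).
Implicit Types (P : set {vec R ^ Y}) (u v w : {vec R ^ Y}).

Lemma affine_hull_line P u w (s : R) :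
  P u -> P w -> affine_hull P (u + s *: (w - u)).
Proof.
move=> Pu Pw; exists 2%N, (fun i => if i == 0 then 1 - s else s),
  (fun i => if i == 0 then u else w); split.
- by move=> i; case: ifP.
- by rewrite big_ord_recl big_ord1 /= subrK.
- by rewrite big_ord_recl big_ord1 /= scalerBr scalerBl scale1r addrAC addrA.
Qed.

(** The line through two points of [P] lies in the affine hull, so two points
    that differ by any nonzero multiple of [v] already make [v] tangent. *)
Lemma tangent_of_segment P u v (s : R) :
  P u -> P (u + s *: v) -> s != 0 -> tangent_space P v.
Proof.
move=> Pu Pus s0; exists (u + v), u; split; last by rewrite addrC addKr.
  have := affine_hull_line s^-1 Pu Pus.
  by rewrite addrAC subrr add0r scalerA mulVf // scale1r.
by have := affine_hull_line 0 Pu Pu; rewrite scale0r addr0.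
Qed.

(** Otherwise [u y = 0], and stepping from [u] a little away from [w] would give
    a point of [P] with negative coordinate at [y]. *)
Lemma relint_pos P u y :
  (forall v, P v -> 0 <= v y) -> relint P u ->
  (exists2 w, P w & 0 < w y) -> 0 < u y.
Proof.
move=> Pge0 [Pu [e e0 eP]] [w Pw wy].
rewrite lt_neqAle Pge0 // andbT; apply/eqP => uy0.
(* [N] dominates every coordinate of [w - u], so a step of length [e / N / 2]
   stays within distance [e]; the 1 keeps [N] positive. *)
pose N := 1 + \sum_z `|w z - u z|.
have N0 : 0 < N by rewrite ltr_pwDl // sumr_ge0.
pose s := - (e / N / 2).
have : P (u + s *: (w - u)).
  apply: eP => [|z]; first exact: affine_hull_line.
  rewrite !ffunE addrAC subrr add0r normrZ normrN ger0_norm; last first.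
    by rewrite !divr_ge0 // ltW.
  have zN : `|w z - u z| <= N.
    by rewrite /N (bigD1 z) //= addrCA lerDl addr_ge0 // sumr_ge0.
  apply: (@le_lt_trans _ _ (e / N / 2 * N)).
    by apply: ler_wpM2l zN; rewrite !divr_ge0 // ltW.
  rewrite mulrAC divfK ?gt_eqF // ltr_pdivrMr // ltr_pMr //.
  by rewrite ltr1n.
move=> /Pge0; rewrite !ffunE -uy0 subr0 add0r -[_ *: _]/(- (e / N / 2) * w y) mulNr oppr_ge0.
by apply/negP; rewrite -ltNge mulr_gt0 // !divr_gt0.
Qed.

Lemma positive_lower_bound u : (forall y, 0 < u y) ->
  exists2 e : R, 0 < e & forall y, e <= u y.
Proof.
move=> u0; exists (\big[Order.min/1]_y u y).
  by elim/big_ind : _ => // a b a0 b0; rewrite lt_min a0.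
by move=> y; rewrite (bigD1 y) //= ge_min lexx.
Qed.

Lemma positive_step u v : (forall y, 0 < u y) ->
  exists2 s : R, 0 < s & forall y, 0 <= (u + s *: v) y.
Proof.
move=> /positive_lower_bound[e e0 eu].
pose N := 1 + \sum_z `|v z|.
have N0 : 0 < N by rewrite ltr_pwDl // sumr_ge0.
exists (e / N); first by rewrite divr_gt0.
move=> y; rewrite !ffunE -lerBlDr sub0r; apply: le_trans (eu y).
rewrite -scalerN (@le_trans _ _ (e / N * N)) //; last by rewrite divfK ?gt_eqF.
apply: ler_wpM2l; first by rewrite divr_ge0 // ltW.
apply: le_trans (ler_norm _) _.
by rewrite normrN /N (bigD1 y) //= addrCA lerDl addr_ge0 // sumr_ge0.
Qed.

Lemma affine_hull_simplex u : affine_hull (@simplex R Y) u -> \sum_y u y = 1.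
Proof.
move=> [k [a [b [bP a1 ->]]]].
under eq_bigr do rewrite sum_ffunE.
rewrite exchange_big /= -a1; apply: eq_bigr => i _.
under eq_bigr do rewrite ffunE.
by rewrite -mulr_sumr (bP i).2 mulr1.
Qed.

Lemma tangent_simplex v : tangent_space (@simplex R Y) v -> \sum_y v y = 0.
Proof.
move=> [a [b [/affine_hull_simplex a1 /affine_hull_simplex b1 ->]]].
under eq_bigr do rewrite !ffunE.
by rewrite sumrB a1 b1 subrr.
Qed.

Lemma relint_simplex u :
  (forall y, 0 < u y) -> \sum_y u y = 1 -> relint (@simplex R Y) u.
Proof.
move=> u0 u1; split; first by split=> // y; exact: ltW.
have [e e0 eu] := positive_lower_bound u0; exists e => // v /affine_hull_simplex v1 vu.
split=> // y; have := vu y; rewrite ltr_norml => /andP[+ _].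
by rewrite ltrBrDl => /ltW; apply: le_trans; rewrite subr_ge0 eu.
Qed.

Lemma simplex_tangent u v : (forall y, 0 < u y) -> \sum_y u y = 1 ->
  \sum_y v y = 0 -> tangent_space (@simplex R Y) v.
Proof.
move=> u0 u1 v0; have [s s0 us] := positive_step v u0.
apply: (@tangent_of_segment _ u v s) => //; last by rewrite gt_eqF.
  by split=> // y; exact: ltW.
split=> //; under eq_bigr do rewrite !ffunE.
by rewrite big_split /= -scaler_sumr v0 scaler0 addr0.
Qed.

Lemma euclidean_grad_dotv (c u : {vec R ^ Y}) : euclidean_grad (dotv c) u = c.
Proof.
apply/ffunP => y; rewrite ffunE.
have -> : (fun h : R => dotv c (u + h *: delta_vec R y)) =
          cst (dotv c u) + id * cst (c y : R).
  apply/funext => h; rewrite -[RHS]/(dotv c u + h * c y) /dotv.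
  under [LHS]eq_bigr do rewrite ffunE [X in _ + X]ffunE ffunE mulrDr.
  rewrite big_split /=; congr (_ + _).
  rewrite (bigD1 y) //= eqxx big1 ?addr0 => [|z /negPf ->].
    by rewrite [h *: _]mulr1 mulrC.
  by rewrite scaler0 mulr0.
rewrite derive1E deriveD // deriveM // !derive_cst derive_id scaler0 !add0r.
exact: mulr1.
Qed.

(** Dividing by [mu] in the metric leaves [c - k], and the constant [k] is
    orthogonal to the vectors of sum zero, which are the tangent vectors. *)
Lemma fisher_rao_grad_score (mu c : {vec R ^ Y}) (k : R) :
  (forall y, 0 < mu y) -> \sum_y mu y = 1 ->
  \sum_y mu y * (c y - k) = 0 ->
  is_fisher_rao_grad (@simplex R Y) (dotv c) mu [ffun y => mu y * (c y - k)].
Proof.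
move=> mu0 mu1 ck; split.
  by apply: (simplex_tangent mu0 mu1); under eq_bigr do rewrite ffunE.
move=> v /tangent_simplex v0; rewrite euclidean_grad_dotv.
transitivity (dotv c v - k * \sum_y v y); last by rewrite v0 mulr0 subr0.
rewrite /fisher_rao mulr_sumr -sumrB; apply: eq_bigr => y _.
by rewrite ffunE -!mulrA mulrC !mulrA divfK ?gt_eqF // mulrBl.
Qed.
End Polytopes.

(** * The pseudo-inverse of a Gram matrix as a projection *)

Section NaturalGradient.
Variables (R : realType) (Y : finType).

Lemma fisher_rao_suml (I : finType) (mu w : {vec R ^ Y}) (a : I -> R)
    (J : I -> {vec R ^ Y}) :
  fisher_rao mu (\sum_i a i *: J i) w = \sum_i a i * fisher_rao mu (J i) w.
Proof.
rewrite /fisher_rao; under [RHS]eq_bigr do rewrite mulr_sumr.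
rewrite exchange_big /=; apply: eq_bigr => y _.
rewrite sum_ffunE !mulr_suml; apply: eq_bigr => i _.
by rewrite ffunE -!mulrA.
Qed.

Lemma fisher_raoC (mu v w : {vec R ^ Y}) : fisher_rao mu v w = fisher_rao mu w v.
Proof. by apply: eq_bigr => y _; rewrite [v y * _]mulrC. Qed.

Lemma fisher_rao_eq0 (mu v : {vec R ^ Y}) :
  (forall y, 0 < mu y) -> fisher_rao mu v v = 0 -> v = 0.
Proof.
move=> mu0 /eqP; rewrite psumr_eq0 => [/allP v0|y _]; last first.
  by apply: divr_ge0 (ltW (mu0 y)); exact: (@sqr_ge0 R (v y)).
apply/ffunP => y; rewrite [RHS]ffunE.
have := v0 y (mem_index_enum y).
by rewrite mulf_eq0 mulf_eq0 orbb invr_eq0 [mu y == 0]gt_eqF //= orbF => /eqP.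
Qed.

(** When the coordinates [a] of [w] are not unique, the pseudo-inverse may find
    others, [F^+ F a]; their difference [b] satisfies [F b = 0], so the vector
    [\sum_j b_j J_j] has Fisher-Rao norm zero and vanishes. *)
Lemma pseudo_inverse_projection (p : nat) (mu : {vec R ^ Y})
    (J : 'I_p -> {vec R ^ Y}) (a : 'I_p -> R) :
  (forall y, 0 < mu y) ->
  let w := \sum_j a j *: J j in
  let F := \matrix_(i, j) fisher_rao mu (J i) (J j) in
  let g : 'cV[R]_p := \col_i fisher_rao mu (J i) w in
  \sum_j (pseudo_inverse F *m g) j 0 *: J j = w.
Proof.
move=> mu0 w F g.
have FE (b : 'cV[R]_p) i :
    (F *m b) i 0 = fisher_rao mu (J i) (\sum_j b j 0 *: J j).
  rewrite mxE fisher_raoC fisher_rao_suml; apply: eq_bigr => j _.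
  by rewrite mxE mulrC fisher_raoC.
pose A : 'cV[R]_p := \col_j a j.
have wE : w = \sum_j A j 0 *: J j by apply: eq_bigr => j _; rewrite mxE.
have gE : g = F *m A by apply/colP => i; rewrite mxE FE -wE.
pose b := pseudo_inverse F *m g - A.
have Fb : F *m b = 0.
  rewrite mulmxBr gE !mulmxA; have [-> _ _ _] := pseudo_inverseP F.
  exact: subrr.
have : \sum_j b j 0 *: J j = 0.
  apply: (fisher_rao_eq0 mu0); rewrite fisher_rao_suml big1 // => i _.
  by rewrite -FE Fb [X in _ * X]mxE mulr0.
have -> : \sum_j b j 0 *: J j = \sum_j (pseudo_inverse F *m g) j 0 *: J j - w.
  rewrite wE -sumrB; apply: eq_bigr => j _.
  by rewrite -scalerBl /b [in LHS]mxE [(- A) j 0]mxE.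
by move=> /subr0_eq.
Qed.
End NaturalGradient.

(** * Derivatives of products and curves on the half-line *)

Section Calculus.
Variable R : realType.

Lemma is_derive_bigsum (V : normedModType R) (I : Type) (s : seq I)
    (f : I -> V -> R^o) (df : I -> R^o) (z v : V) :
  (forall i, is_derive z v (f i) (df i)) ->
  is_derive z v (fun z => \sum_(i <- s) f i z) (\sum_(i <- s) df i).
Proof.
move=> fdf; elim: s => [|i s IHs].
  rewrite big_nil (_ : (fun _ => _) = cst 0).
    exact: is_derive_cst.
  by apply/funext => y; rewrite big_nil.
rewrite big_cons (_ : (fun _ => _) = f i + (fun z => \sum_(i <- s) f i z)).
  exact: is_deriveD.
by apply/funext => y; rewrite big_cons.
Qed.

(** The logarithmic form of the product rule is the one in which the scores of
    the factors of an independence model add up. *)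
Lemma is_derive_bigprod (V : normedModType R) (I : Type) (s : seq I)
    (f : I -> V -> R) (df : I -> R) (z v : V) :
  (forall i, is_derive z v (f i) (df i)) -> (forall i, f i z != 0) ->
  is_derive z v (fun z => \prod_(i <- s) f i z)
    ((\prod_(i <- s) f i z) * \sum_(i <- s) df i / f i z).
Proof.
move=> fdf f0; elim: s => [|i s IHs].
  rewrite !big_nil mulr0 (_ : (fun _ => _) = cst 1).
    exact: is_derive_cst.
  by apply/funext => y; rewrite big_nil.
rewrite !big_cons (_ : (fun _ => _) = f i * (fun z => \prod_(i <- s) f i z)).
  apply: is_derive_eq.
  rewrite -![_ *: _]/(_ * _) mulrDr addrC; congr (_ + _); last by rewrite mulrA.
  by rewrite mulrAC mulrCA divff // mulr1 mulrC.
by apply/funext => y; rewrite big_cons.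
Qed.

Lemma differentiable_bigprod (V : normedModType R) (I : Type) (s : seq I)
    (f : I -> V -> R) (z : V) :
  (forall i, differentiable (f i) z) ->
  differentiable (fun z => \prod_(i <- s) f i z) z.
Proof.
move=> fz; elim: s => [|i s IHs].
  rewrite (_ : (fun _ => _) = cst 1); first exact: differentiable_cst.
  by apply/funext => y; rewrite big_nil.
rewrite (_ : (fun _ => _) = f i * (fun z => \prod_(i <- s) f i z)).
  exact: differentiableM.
by apply/funext => y; rewrite big_cons.
Qed.

(** Affine continuation with slope [v 0] to the left of 0 makes the right
    derivative at 0 two-sided. *)
Lemma time_derive_extension (V : normedModType R) (g v : R -> V) :
  (forall t : R, 0 <= t -> is_time_derive g t (v t)) ->
  exists2 G : R -> V, (forall t : R, 0 <= t -> G t = g t) &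
    forall t : R, 0 <= t -> is_derive t 1 G (v t).
Proof.
move=> gv; pose G (s : R) := if 0 <= s then g s else g 0 + s *: v 0.
have Gg (t : R) : 0 <= t -> G t = g t by rewrite /G => ->.
exists G => // t t0.
suff Gt : (fun h : R => h^-1 *: ((G \o shift t) (h *: 1) - G t)) @ 0^' --> v t.
  by split; [apply/cvg_ex; exists (v t) | exact: cvg_lim].
move=> A Av.
have gA : \forall h \near (0 : R)^', 0 <= t + h -> A (h^-1 *: (g (t + h) - g t)).
  exact: gv t t0 A Av.
have t_out : \forall h \near (0 : R)^', 0 <= t + h \/ t = 0.
  move: t0; rewrite le_eqVlt => /predU1P[<-|t0].
    by near=> h; right.
  near=> h; left; rewrite -lerBlDl sub0r.
  have : `|h| < t by near: h; apply: dnbhs0_lt.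
  by rewrite ltr_norml => /andP[/ltW].
suff : \forall h \near (0 : R)^', A (h^-1 *: ((G \o shift t) (h *: 1) - G t)) by [].
near=> h.
have hA : 0 <= t + h -> A (h^-1 *: (g (t + h) - g t)) by near: h; exact: gA.
have ht : 0 <= t + h \/ t = 0 by near: h; exact: t_out.
have h0 : h != 0 by near: h; exact: nbhs_dnbhs_neq.
rewrite /= [h *: 1]mulr1 [h + t]addrC (Gg t) //.
have [th0|th0] := leP 0 (t + h); first by rewrite Gg //; exact: hA.
case: ht => [|tE]; first by rewrite leNgt th0.
rewrite /G leNgt th0 /= tE add0r addrAC subrr add0r scalerA mulVf // scale1r.
by move: (nbhs_singleton Av); rewrite tE.
Unshelve. all: by end_near. Qed.

Lemma is_time_derive_restrict (V : normedModType R) (g G : R -> V) (t : R) (v : V) :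
  (forall s : R, 0 <= s -> G s = g s) -> 0 <= t -> is_derive t 1 G v ->
  is_time_derive g t v.
Proof.
move=> Gg t0 [/cvg_ex[l Gl] Gv].
have lv : l = v by rewrite -Gv; apply/esym/cvg_lim.
move=> A; rewrite -lv => /Gl GA.
suff : \forall h \near (0 : R)^', 0 <= t + h -> A (h^-1 *: (g (t + h) - g t)) by [].
apply: filterS (GA : \forall h \near (0 : R)^', _) => h /= + th0.
by rewrite [h *: 1]mulr1 [h + t]addrC !Gg.
Qed.

Lemma is_derive_curve (p : nat) (g : 'cV[R]_p -> R^o) (Th : R -> 'cV[R]_p)
    (t : R) (v : 'cV[R]_p) :
  differentiable g (Th t) -> is_derive t 1 Th v ->
  is_derive t 1 (g \o Th) (\sum_j v j 0 * 'D_(delta_mx j 0) g (Th t)).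
Proof.
move=> dg [dTh <-].
have dTh' : differentiable Th t by apply/derivable1_diffP.
have dgTh : differentiable (g \o Th) t by apply: differentiable_comp.
split; first exact/derivable1_diffP.
rewrite deriveE // diff_comp //= -[in LHS](deriveE _ dTh').
rewrite [X in 'd _ _ X](matrix_sum_delta ('D_1 Th t)) linear_sum.
apply: eq_bigr => j _; by rewrite big_ord1 linearZ (deriveE _ dg).
Qed.

End Calculus.

(** * Integrating the score flow *)

Section Gibbs.
Variables (R : realType) (Y : finType).

(** The means [k t] depend on the unknown curve, but they are the same for all
    outcomes, so they cancel in the logarithm of the ratio of two coordinates,
    whose derivative is then the constant [c x - c y]. *)
Lemma score_flow_gibbs (mu : R -> Y -> R) (c : Y -> R) (k : R -> R) :
  (forall t y, 0 < mu t y) -> (forall t, \sum_y mu t y = 1) ->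
  (forall (t : R) (y : Y), 0 <= t ->
     is_derive t 1 (fun s => mu s y) (mu t y * (c y - k t))) ->
  forall (t : R) (y : Y), 0 <= t ->
    mu t y = mu 0 y * expR (t * c y) / \sum_z mu 0 z * expR (t * c z).
Proof.
move=> mu0 mu1 dmu t x t0.
have ratio y : mu t x * (mu 0 y * expR (t * c y)) =
               mu t y * (mu 0 x * expR (t * c x)).
  pose r s := ln (mu s x) - ln (mu s y) - s * (c x - c y).
  have dr (s : R) : 0 <= s -> is_derive s 1 r 0.
    move=> s0.
    have dln z : is_derive s 1 (fun u => ln (mu u z)) (c z - k s).
      have := @is_derive1_comp R (@ln R) (fun u => mu u z) s _ _
        (is_derive1_ln (mu0 s z)) (dmu s z s0).
      rewrite mulrC mulrAC divff ?mul1r ?gt_eqF //.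
    have -> : r = (fun u => ln (mu u x)) - (fun u => ln (mu u y))
                  - id * cst (c x - c y) by [].
    apply: is_derive_eq.
    by rewrite scaler0 add0r -[_ *: _]/(_ * _) mulr1 /=; ring.
  have r0 : r t = r 0.
    have [||z _] := @MVT_segment R r (cst 0) 0 t t0.
    - by move=> s; rewrite in_itv /= => /andP[/ltW s0 _]; exact: dr.
    - apply: derivable_within_continuous => s; rewrite in_itv /= => /andP[s0 _].
      by have [] := dr s s0.
    - by rewrite mul0r => /subr0_eq.
  move: r0; rewrite /r mul0r subr0 => /eqP; rewrite subr_eq => /eqP r0.
  have lnE : ln (mu t x) + (ln (mu 0 y) + t * c y) =
             ln (mu t y) + (ln (mu 0 x) + t * c x).
    by move: r0 => /eqP; rewrite subr_eq => /eqP ->; ring.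
  have := congr1 expR lnE.
  by rewrite !expRD !lnK // posrE.
have S0 : \sum_z mu 0 z * expR (t * c z) != 0.
  rewrite gt_eqF // (bigD1 x) //= ltr_pwDl ?mulr_gt0 ?expR_gt0 //.
  by apply: sumr_ge0 => z _; rewrite ltW // mulr_gt0 ?expR_gt0.
apply/eqP; rewrite -[_ == _](inj_eq (mulIf S0)) divfK // mulr_sumr.
by under eq_bigr do rewrite ratio; rewrite -mulr_suml mu1 mul1r.
Qed.
End Gibbs.

(** * Independence models *)

Section IndependenceModel.
Variables (R : realType) (X : finType) (n : nat).
Implicit Types q v : {vec R ^ 'I_n * X}.

Lemma relint_cond_simplex_pos q ix : relint (@cond_simplex R X n) q -> 0 < q ix.
Proof.
case: ix => i x qP; apply: (relint_pos _ qP) => [v vP|].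
  by have := (vP i).1 x; rewrite ffunE.
exists [ffun jx => (jx.2 == x)%:R]; last by rewrite ffunE eqxx ltr01.
move=> j; split=> [y|]; first by rewrite !ffunE ler0n.
rewrite (bigD1 x) //= !ffunE eqxx big1 ?addr0 // => y /negPf yx.
by rewrite !ffunE /= yx.
Qed.

Lemma cond_simplex_sum q i : cond_simplex q -> \sum_x q (i, x) = 1.
Proof. by move=> qP; rewrite -(qP i).2; under [RHS]eq_bigr do rewrite ffunE. Qed.

(** A relative interior point has positive coordinates, so a small step in any
    direction that preserves the sums stays in the polytope. *)
Lemma tangent_cond_simplex q v :
  relint (@cond_simplex R X n) q -> (forall i, \sum_x v (i, x) = 0) ->
  tangent_space (@cond_simplex R X n) v.
Proof.
move=> qr v0; have q0 ix := relint_cond_simplex_pos ix qr.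
have [s s0 qs] := positive_step v q0.
apply: (@tangent_of_segment _ _ _ q v s); [exact: qr.1| |by rewrite gt_eqF].
move=> i; split=> [x|]; first by have := qs (i, x); rewrite !ffunE.
under eq_bigr do rewrite !ffunE.
by rewrite big_split /= -scaler_sumr v0 scaler0 addr0 cond_simplex_sum //; exact: qr.1.
Qed.

Lemma sum_tuple_prod (F : 'I_n -> X -> R) :
  \sum_(x : n.-tuple X) \prod_i F i (tnth x i) = \prod_i \sum_x F i x.
Proof.
rewrite bigA_distr_bigA.
rewrite (reindex (fun f : {ffun 'I_n -> X} => [tuple f i | i < n])) /=.
  apply: eq_bigr => f _; apply: eq_bigr => i _.
  by rewrite tnth_mktuple.
apply: onW_bij; exists (fun x => [ffun i => tnth x i]) => f.
  by apply/ffunP => i; rewrite ffunE tnth_mktuple.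
by apply: eq_from_tnth => i; rewrite tnth_mktuple ffunE.
Qed.

Lemma slot_vecE i y (x : n.-tuple X) :
  slot_vec R i y x = (tnth x i == y)%:R.
Proof.
rewrite ffunE (bigD1 i) //= eqxx ffunE big1 ?mulr1 // => j /negPf ->.
by rewrite ffunE.
Qed.

(** A slot vector depends on a single coordinate of the tuple, so its span
    consists of sums of functions of one coordinate each. *)
Lemma slot_span_additive (c : {vec R ^ n.-tuple X}) :
  c \in <<[seq slot_vec R ix.1 ix.2 | ix : 'I_n * X]>>%VS ->
  exists a : 'I_n -> X -> R, forall x, c x = \sum_i a i (tnth x i).
Proof.
move=> /mem_span_image[a ->]; exists (fun i x => a (i, x)) => x.
transitivity (\sum_i \sum_y a (i, y) *: ((tnth x i == y)%:R : R^o)).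
  rewrite pair_bigA sum_ffunE; apply: eq_bigr => -[i y] _.
  by rewrite ffunE slot_vecE.
apply: eq_bigr => i _; rewrite (bigD1 (tnth x i)) //= eqxx big1.
  by rewrite addr0 [_ *: _]mulr1.
by move=> y; rewrite eq_sym => /negPf ->; rewrite scaler0.
Qed.

Section Param.
Variables (p : nat) (m : 'cV[R]_p -> {vec R ^ 'I_n * X}).
Hypothesis m_diff : forall (z : 'cV[R]_p) (ix : 'I_n * X),
  differentiable (fun z => m z ix : R^o) z.
Hypothesis m_relint : forall z, relint (@cond_simplex R X n) (m z).

Let m_pos z ix : 0 < m z ix.
Proof. exact: relint_cond_simplex_pos. Qed.

Lemma independence_model_pos z x : 0 < independence_model m z x.
Proof. by rewrite ffunE prodr_gt0. Qed.

Lemma independence_model_sum1 z : \sum_x independence_model m z x = 1.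
Proof.
under eq_bigr do rewrite ffunE.
rewrite (sum_tuple_prod (fun i x => m z (i, x))) big1 // => i _.
exact/cond_simplex_sum/(m_relint z).1.
Qed.

Lemma is_derive_independence_model z j x :
  is_derive z (delta_mx j 0 : 'cV[R]_p) (fun z => independence_model m z x : R^o)
    (independence_model m z x *
     \sum_i param_partial m z j (i, tnth x i) / m z (i, tnth x i)).
Proof.
rewrite (_ : (fun _ => _) = fun z => \prod_(i < n) m z (i, tnth x i)); last first.
  by apply/funext => y; rewrite ffunE.
rewrite ffunE.
apply: (@is_derive_bigprod _ _ _ _ (fun i z => m z (i, tnth x i))) => i.
  rewrite ffunE; apply: derivableP; exact: diff_derivable.
by rewrite gt_eqF.
Qed.

Lemma independence_model_differentiable z x :
  differentiable (fun z => independence_model m z x : R^o) z.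
Proof.
rewrite (_ : (fun _ => _) = fun z => \prod_(i < n) m z (i, tnth x i)); last first.
  by apply/funext => y; rewrite ffunE.
by apply: (@differentiable_bigprod _ _ _ _ (fun i z => m z (i, tnth x i))) => i.
Qed.

Lemma param_partial_sum0 z j :
  \sum_x param_partial (independence_model m) z j x = 0.
Proof.
under eq_bigr => x _ do
  rewrite ffunE (@derive_val _ _ _ _ _ _ _ (is_derive_independence_model z j x)).
have := is_derive_bigsum (index_enum (n.-tuple X)) (is_derive_independence_model z j).
rewrite (_ : (fun _ => _) = cst 1); last first.
  by apply/funext => y; rewrite independence_model_sum1.
by move=> [_ <-]; rewrite derive_cst.
Qed.

Lemma param_grad_dotv (c : {vec R ^ n.-tuple X}) z j :
  param_grad (fun z => dotv c (independence_model m z)) z j 0 =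
  dotv c (param_partial (independence_model m) z j).
Proof.
rewrite mxE.
have d x : is_derive z (delta_mx j 0 : 'cV[R]_p)
    (fun z => c x * independence_model m z x : R^o)
    (c x * param_partial (independence_model m) z j x).
  have dx := is_derive_independence_model z j x.
  rewrite ffunE (@derive_val _ _ _ _ _ _ _ dx).
  exact: (@is_deriveZ _ _ _ _ (c x : R) _ _ _ dx).
exact: (@derive_val _ _ _ _ _ _ _ (is_derive_bigsum (index_enum (n.-tuple X)) d)).
Qed.

Hypothesis m_span : forall z v, (forall i, \sum_x v (i, x) = 0) ->
  v \in <<[seq param_partial m z i | i : 'I_p]>>%VS.

(** The combination [b] is the one that moves every factor [m(.|i)] along the
    score [m(.|i) (a_i - A_i)] of its own function [a_i]. *)
Lemma score_in_model_span (a : 'I_n -> X -> R) z :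
  exists (b : 'I_p -> R) (k : R),
    \sum_j b j *: param_partial (independence_model m) z j =
    [ffun x => independence_model m z x * (\sum_i a i (tnth x i) - k)].
Proof.
pose A i := \sum_x m z (i, x) * a i x.
pose v : {vec R ^ 'I_n * X} := [ffun ix => m z ix * (a ix.1 ix.2 - A ix.1)].
have [|b vE] := @mem_span_image _ _ _ (param_partial m z) v.
  apply: m_span => i; under eq_bigr do rewrite ffunE mulrBr.
  rewrite sumrB /= -mulr_suml cond_simplex_sum; last exact: (m_relint z).1.
  by rewrite mul1r subrr.
exists b, (\sum_i A i); apply/ffunP => x.
rewrite sum_ffunE [RHS]ffunE.
transitivity (\sum_j independence_model m z x *
    \sum_i b j * param_partial m z j (i, tnth x i) / m z (i, tnth x i)).
  apply: eq_bigr => j _; rewrite ffunE [X in _ *: X]ffunE.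
  rewrite (@derive_val _ _ _ _ _ _ _ (is_derive_independence_model z j x)).
  rewrite -[_ *: _]/(_ * _) mulrCA mulr_sumr; congr (_ * _).
  by apply: eq_bigr => i _; rewrite mulrA.
rewrite -mulr_sumr exchange_big /= -sumrB; congr (_ * _).
apply: eq_bigr => i _; rewrite -mulr_suml.
have -> : \sum_j b j * param_partial m z j (i, tnth x i) = v (i, tnth x i).
  by rewrite vE sum_ffunE; apply: eq_bigr => j _; rewrite [in RHS]ffunE.
by rewrite ffunE /= mulrC mulKf // gt_eqF.
Qed.

(** By [score_in_model_span] the Fisher-Rao gradient of the payoff lies in the
    span of the partial derivatives, where the natural gradient projection is the
    identity. *)
Lemma natural_gradient_score (c : {vec R ^ n.-tuple X}) z :
  c \in <<[seq slot_vec R ix.1 ix.2 | ix : 'I_n * X]>>%VS ->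
  exists k : R,
    (\sum_x independence_model m z x * (c x - k) = 0) /\
    forall x, \sum_j (pseudo_inverse (fisher_matrix (independence_model m) z) *m
        param_grad (fun z => dotv c (independence_model m z)) z) j 0 *
        param_partial (independence_model m) z j x =
      independence_model m z x * (c x - k).
Proof.
move=> /slot_span_additive[a ca].
have [b [k bk]] := score_in_model_span a z.
have mu0 := independence_model_pos z; have mu1 := independence_model_sum1 z.
pose w := [ffun x => independence_model m z x * (c x - k)]
  : {vec R ^ n.-tuple X}.
have {}bk : \sum_j b j *: param_partial (independence_model m) z j = w.
  by rewrite bk; apply/ffunP => x; rewrite !ffunE -ca.
(* Summing the span relation over the outcomes identifies [k] as the mean. *)
have w0 : \sum_x independence_model m z x * (c x - k) = 0.
  transitivity (\sum_x w x); first by apply: eq_bigr => x _; rewrite [RHS]ffunE.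
  rewrite -bk; under eq_bigr do rewrite sum_ffunE.
  rewrite exchange_big /= big1 // => j _; under eq_bigr do rewrite ffunE.
  by rewrite -scaler_sumr param_partial_sum0 scaler0.
exists k; split=> // x.
have [_ wgrad] := fisher_rao_grad_score mu0 mu1 w0.
have gradE : param_grad (fun z => dotv c (independence_model m z)) z =
    \col_i fisher_rao (independence_model m z)
      (param_partial (independence_model m) z i)
      (\sum_j b j *: param_partial (independence_model m) z j).
  apply/colP => j; rewrite param_grad_dotv [RHS]mxE bk.
  rewrite fisher_raoC wgrad ?euclidean_grad_dotv //.
  exact: (simplex_tangent mu0 mu1 (param_partial_sum0 z j)).
have := pseudo_inverse_projection (param_partial (independence_model m) z) b mu0.
rewrite /= -gradE bk => /ffunP/(_ x); rewrite sum_ffunE [RHS]ffunE => <-.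
by apply: eq_bigr => j _; rewrite [RHS]ffunE.
Qed.

End Param.
End IndependenceModel.

Theorem theorem4p9 (R : realType) (X : finType) (n p : nat)
    (m : 'cV[R]_p -> {vec R ^ 'I_n * X})
    (m_diff : forall (theta : 'cV[R]_p) (ix : 'I_n * X),
       differentiable (fun z => m z ix : R^o) theta)
    (m_range : range m = relint (@cond_simplex R X n))
    (m_span : forall theta : 'cV[R]_p,
       [set v | v \in <<[seq param_partial m theta i | i : 'I_p]>>%VS]
       = tangent_space (@cond_simplex R X n))
    (c : {vec R ^ n.-tuple X})
    (c_span : c \in <<[seq slot_vec R ix.1 ix.2 | ix : 'I_n * X]>>%VS)
    (theta : R -> 'cV[R]_p)
    (theta_flow : natural_gradient_flow (independence_model m) (dotv c) theta) :
  let mu := fun t : R => independence_model m (theta t) in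
  [/\ fisher_rao_flow (@simplex R (n.-tuple X)) (dotv c) mu,
      forall (t : R) (x : n.-tuple X), 0 <= t ->
        mu t x = mu 0 x * expR (t * c x)
                 / \sum_(x' : n.-tuple X) mu 0 x' * expR (t * c x')
    & (forall x : n.-tuple X, mu 0 x = #|{: n.-tuple X}|%:R^-1) ->
      forall (t : R) (x : n.-tuple X), 0 <= t ->
        mu t x = expR (t * c x) / \sum_(x' : n.-tuple X) expR (t * c x')].
Proof.
have m_relint z : relint (@cond_simplex R X n) (m z) by rewrite -m_range; exists z.
have mu0 := independence_model_pos m_relint.
have mu1 := independence_model_sum1 m_relint.
have T_span z (v : {vec R ^ 'I_n * X}) : (forall i, \sum_x v (i, x) = 0) ->
    v \in <<[seq param_partial m z i | i : 'I_p]>>%VS.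
  move=> v0; have := tangent_cond_simplex (m_relint z) v0.
  by rewrite -(m_span z).
have score (t : R) := natural_gradient_score m_diff m_relint T_span (theta t) c_span.
have [k /all_and2[k0 kV]] := choice score.
have [Th Thth dTh] := time_derive_extension theta_flow.
have dmu (t : R) x : 0 <= t ->
    is_derive t 1 (fun s => independence_model m (Th s) x : R^o)
      (independence_model m (Th t) x * (c x - k t)).
  move=> t0; rewrite [in X in is_derive _ _ _ X]Thth // -kV.
  have := @is_derive_curve R p (fun z => independence_model m z x) Th t _
     (independence_model_differentiable m_diff _ _) (dTh t t0).
  rewrite Thth // => dcurve; apply: (is_derive_eq dcurve).
  by apply: eq_bigr => j _; rewrite [param_partial _ _ _ x]ffunE.
move=> mu.
have gibbs (t : R) (x : n.-tuple X) : 0 <= t ->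
    mu t x = mu 0 x * expR (t * c x) / \sum_x' mu 0 x' * expR (t * c x').
  move=> t0.
  have := score_flow_gibbs (fun t : R => mu0 (Th t)) (fun t : R => mu1 (Th t)) dmu x t0.
  by rewrite !Thth.
split=> //.
  move=> t t0; split; first exact: (relint_simplex (mu0 _) (mu1 _)).
  exists [ffun x => mu t x * (c x - k t)].
    exact: (fisher_rao_grad_score (mu0 _) (mu1 _) (k0 t)).
  move=> x; rewrite ffunE.
  apply: (@is_time_derive_restrict _ _ _
    (fun s => independence_model m (Th s) x : R^o)) => //.
    by move=> s s0; rewrite Thth.
  by rewrite /mu -Thth //; exact: dmu.
move=> unif t x t0; rewrite gibbs // unif.
under eq_bigr do rewrite unif.
have N0 : (#|{: n.-tuple X}|%:R : R)^-1 != 0.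
  by rewrite -(unif x); exact: lt0r_neq0 (mu0 _ _).
by rewrite -mulr_sumr invfM mulrACA divff // mul1r.
Qed.
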